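(* Let $\mathcal{Z}\subseteq\mathbb{R}^d$, let $f:\mathcal{Z}\to\mathcal{Z}$, let $(z_t)_{t\ge 0}$ be a rollout $z_{t+1}=f(z_t)$ with $z_0\in\mathcal{Z}$, and define $v(z):=f(z)-z$. Assume that $v$ is $\varepsilon$-Lipschitz on the set of states visited by the rollout, with $0<\varepsilon<1$, i.e. $\|v(z)-v(z')\|\le\varepsilon\|z-z'\|$ for all $z,z'\in\{z_t:t\ge 0\}$. Then for every $t$ such that $v(z_t)\ne 0$ and $v(z_{t+1})\ne 0$, $$\mathcal{L}_{\mathrm{curv}}(t)\le\frac{\varepsilon^2}{2(1-\varepsilon)}.$$
   Context: $\|\cdot\|$ is the Euclidean norm. $\mathcal{Z}$ is the latent state space, $f$ the learned latent dynamics, and $v$ the latent velocity map. For $t$ with $v(z_t)\neq0$ and $v(z_{t+1})\ne0$, the temporal straightening curvature loss is $$\mathcal{L}_{\mathrm{curv}}(t):=1-\frac{v(z_t)^\top v(z_{t+1})}{\|v(z_t)\|\,\|v(z_{t+1})\|}.$$ *)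

(* Defs.v *)
From mathcomp Require Import all_boot all_order all_algebra.
From mathcomp Require Import all_classical all_reals.

Set Implicit Arguments.
Unset Strict Implicit.
Unset Printing Implicit Defensive.

Import Order.TTheory GRing.Theory Num.Theory.

Local Open Scope ring_scope.

(* The library norm on matrices is the sup norm, hence this definition. *)
Definition enorm (R : realType) (d : nat) (u : 'cV[R]_d) : R :=
  Num.sqrt (\sum_(i < d) u i 0 ^+ 2).

Definition velocity (R : realType) (d : nat) (f : 'cV[R]_d -> 'cV[R]_d)
    (x : 'cV[R]_d) : 'cV[R]_d :=
  f x - x.

(* [u^T *m w] is a 1 x 1 matrix; its single entry is the dot product of u, w.
   The value is meaningful only when both v (z t) and v (z t.+1) are nonzero. *)
Definition curv_loss (R : realType) (d : nat) (v : 'cV[R]_d -> 'cV[R]_d)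
    (z : nat -> 'cV[R]_d) (t : nat) : R :=
  1 - ((v (z t))^T *m v (z t.+1)) 0 0 / (enorm (v (z t)) * enorm (v (z t.+1))).

(* Main.v *)
(* Put a = v(z_t), b = v(z_{t+1}).  Since z_{t+1} - z_t = a, the Lipschitz bound
   reads |b - a| <= eps |a|; expanding the square bounds
   2 (|a||b| - <a, b>) by eps^2 |a|^2 - (|a| - |b|)^2.  If |b| >= (1 - eps) |a|,
   dropping the last square gives the claim; otherwise the bound is negative.
   (The second case is in fact excluded by the triangle inequality, but
   treating it directly makes Cauchy-Schwarz unnecessary.) *)

Require Import Defs.
From mathcomp Require Import all_boot all_order all_algebra.
From mathcomp Require Import all_classical all_reals.
From mathcomp Require Import ring lra.

Import Order.TTheory GRing.Theory Num.Theory.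
Local Open Scope classical_set_scope.
Local Open Scope ring_scope.

Lemma enorm_ge0 (R : realType) (d : nat) (u : 'cV[R]_d) : 0 <= enorm u.
Proof. exact: sqrtr_ge0. Qed.

Lemma sqr_enorm (R : realType) (d : nat) (u : 'cV[R]_d) :
  enorm u ^+ 2 = \sum_(i < d) u i 0 ^+ 2.
Proof. by rewrite sqr_sqrtr // sumr_ge0 // => i _; exact: sqr_ge0. Qed.

Lemma enorm_gt0 (R : realType) (d : nat) (u : 'cV[R]_d) :
  u != 0 -> 0 < enorm u.
Proof.
move=> u0; rewrite lt_def enorm_ge0 andbT; apply: contra u0 => /eqP nu0.
have /eqP := sqr_enorm _ _ u; rewrite nu0 expr0n eq_sym psumr_eq0; last first.
  by move=> i _; exact: sqr_ge0.
move=> /allP u2; apply/eqP/matrixP => i j; rewrite ord1 mxE.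
by apply/eqP; rewrite -sqrf_eq0; apply: u2; rewrite mem_index_enum.
Qed.

Lemma sqr_enormB (R : realType) (d : nat) (u w : 'cV[R]_d) :
  enorm (u - w) ^+ 2 = enorm u ^+ 2 + enorm w ^+ 2 - 2 * (u^T *m w) 0 0.
Proof.
rewrite !sqr_enorm mxE mulr_sumr -big_split /= -sumrB.
by apply: eq_bigr => i _; rewrite !mxE; ring.
Qed.

(** The scalar core: [a] and [b] stand for the two norms, [s] for the dot product, and the last
    hypothesis is the squared Lipschitz bound expanded by [sqr_enormB]. *)
Lemma one_minus_cos_le (R : realFieldType) (a b s e : R) :
  0 < a -> 0 < b -> 0 < e -> e < 1 ->
  a ^+ 2 + b ^+ 2 - 2 * s <= e ^+ 2 * a ^+ 2 ->
  1 - s / (a * b) <= e ^+ 2 / (2 * (1 - e)).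
Proof.
move=> a0 b0 e0 e1 h.
have e1' : 0 < 1 - e by rewrite subr_gt0.
have ab0 : 0 < a * b by rewrite mulr_gt0.
rewrite ler_pdivlMr ?mulr_gt0 //.
have -> : (1 - s / (a * b)) * (2 * (1 - e)) =
          2 * (a * b - s) * (1 - e) / (a * b).
  by field; rewrite !gt_eqF.
rewrite ler_pdivrMr //.
have h1 : 2 * (a * b - s) <= e ^+ 2 * a ^+ 2 - (a - b) ^+ 2.
  by rewrite sqrrB; lra.
apply: le_trans (ler_wpM2r (ltW e1') h1) _.
have [hb|hb] := leP ((1 - e) * a) b.
  (* The goal is the sum of two inequalities: the dropped square, and [hb] multiplied by
     [e ^+ 2 * a]. *)
  have : 0 <= (a - b) ^+ 2 * (1 - e) by rewrite mulr_ge0 ?sqr_ge0 ?ltW.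
  have : e ^+ 2 * a * ((1 - e) * a) <= e ^+ 2 * a * b.
    by rewrite ler_wpM2l // mulr_ge0 ?sqr_ge0 ?ltW.
  nra.
(* Here [a - b > e * a > 0], so squaring preserves the order and 0 separates the two sides of the
   goal. *)
have hab : (e * a) ^+ 2 <= (a - b) ^+ 2.
  by rewrite ler_sqr ?nnegrE; nra.
apply: (@le_trans _ _ 0).
  by rewrite mulr_le0_ge0 ?(ltW e1') // -exprMn subr_le0.
by rewrite mulr_ge0 ?sqr_ge0 ?ltW.
Qed.

Theorem proposition1 (R : realType) (d : nat) (Z : set 'cV[R]_d)
    (f : 'cV[R]_d -> 'cV[R]_d) (fZ : set_fun Z Z f)
    (z : nat -> 'cV[R]_d) (z0 : Z (z 0%N))
    (zS : forall t : nat, z t.+1 = f (z t))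
    (eps : R) (eps_gt0 : 0 < eps) (eps_lt1 : eps < 1)
    (v_lip : forall x y : 'cV[R]_d, range z x -> range z y ->
       enorm (velocity f x - velocity f y) <= eps * enorm (x - y)) :
  forall t : nat,
    velocity f (z t) != 0 -> velocity f (z t.+1) != 0 ->
    curv_loss (velocity f) z t <= eps ^+ 2 / (2 * (1 - eps)).
Proof.
move=> t vt0 vt1; apply: one_minus_cos_le => //; try exact: enorm_gt0.
rewrite -sqr_enormB -exprMn ler_sqr ?nnegrE ?mulr_ge0 ?enorm_ge0 ?(ltW eps_gt0) //.
(* In this order of arguments the displacement is minus the velocity; the norm absorbs the sign. *)
have zB : z t - z t.+1 = - velocity f (z t) by rewrite zS opprB.
have := v_lip (z t) (z t.+1) (imageT z t) (imageT z t.+1).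
rewrite zB; congr (_ <= _ * _).
by rewrite /enorm; congr Num.sqrt; apply: eq_bigr => i _; rewrite mxE sqrrN.
Qed.
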